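(* Let $\alpha,\beta$ be real numbers with $\tan(\alpha)=\frac{1}{\sqrt{2}}$ and $\tan(\beta)=\sqrt{8}+\sqrt{3}$. Then $$Cl_{2}(\pi-2\beta)+Cl_{2}(2\beta-4\alpha)+Cl_{2}(2\beta-2\alpha)-Cl_{2}(2\beta+2\alpha-\pi)-Cl_{2}(2\alpha)-2Cl_{2}(\pi-4\alpha)-2Cl_{2}(\pi+2\alpha)=0.$$
   Context: $Cl_2$ denotes the Clausen function on $\mathbb{R}$: $Cl_{2}(x)=-\int_{0}^{x}\log\left(2\left|\sin\frac{\varphi}{2}\right|\right)d\varphi=\sum_{n=1}^{\infty}\frac{\sin(nx)}{n^{2}}$. *)

(* Defs.v *)
From Stdlib Require Import Reals Lra.
From Coquelicot Require Import Coquelicot.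
Open Scope R_scope.

(* The index n >= 1 of the sine series is S n here.  The series converges for
   every real x (ex_series_Cl2), so Series is its genuine sum.  The integral
   of - log (2 |sin (phi / 2)|) from 0 to x has the same value, but it is
   improper at 0 and at every multiple of 2 PI, so RInt cannot express it. *)
Definition Cl2 (x : R) : R :=
  Series (fun n : nat => sin (INR (S n) * x) / INR (S n) ^ 2).

Lemma ex_series_Cl2 (x : R) :
  ex_series (fun n : nat => sin (INR (S n) * x) / INR (S n) ^ 2).
Proof.
apply (ex_series_le (V := R_CompleteNormedModule)) with
  (b := fun n : nat => 2 * (/ INR (S n) - / INR (S (S n)))).
- intros n. change norm with Rabs.
  assert (Hn : 0 < INR (S n)) by (apply lt_0_INR, Nat.lt_0_succ).
  assert (H1 : 1 <= INR (S n)).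
  { rewrite S_INR. generalize (pos_INR n). lra. }
  rewrite (S_INR (S n)).
  unfold Rdiv. rewrite Rabs_mult.
  assert (H2 : 0 < INR (S n) ^ 2) by (apply pow_lt; exact Hn).
  rewrite (Rabs_pos_eq (/ _)) by (apply Rlt_le, Rinv_0_lt_compat, H2).
  apply Rle_trans with (1 * / INR (S n) ^ 2).
  + apply Rmult_le_compat_r; [apply Rlt_le, Rinv_0_lt_compat, H2|].
    apply Rabs_le. generalize (SIN_bound (INR (S n) * x)). lra.
  + set (y := INR (S n)) in *.
    apply Rminus_le_0.
    replace (_ - _) with ((y - 1) * / (y ^ 2 * (y + 1))) by (field; lra).
    apply Rmult_le_pos; [lra|].
    apply Rlt_le, Rinv_0_lt_compat, Rmult_lt_0_compat; lra.
- apply (ex_series_scal_l (K := R_AbsRing) 2 (fun n => / INR (S n) - / INR (S (S n)))).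
  exists 1. change (is_lim_seq (sum_n (fun n => / INR (S n) - / INR (S (S n)))) 1).
  apply is_lim_seq_ext with (fun n => 1 - / INR (S (S n))).
  + intros n. induction n as [|n IH].
    * rewrite sum_O. simpl. lra.
    * rewrite sum_Sn, <- IH. change plus with Rplus. lra.
  + replace (Finite 1) with (Finite (1 - 0)) by (f_equal; lra).
    apply is_lim_seq_minus'; [apply is_lim_seq_const|].
    apply (is_lim_seq_ext (fun n => / INR (n + 2))).
    { intros n. f_equal. f_equal. rewrite Nat.add_comm. reflexivity. }
    apply (is_lim_seq_incr_n (fun n => / INR n) 2 0).
    apply (is_lim_seq_inv INR p_infty); [apply is_lim_seq_INR|discriminate].
Qed.

(* Main.v *)
(** With [Lob x = Cl2 (2 x) / 2] (Milnor's Lobachevsky function), [Lob] is odd,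
[PI]-periodic and [Lob' = - ln (2 sin)] on [(0, PI)].  Let [u = e^(2 i alpha)],
let [D] be the Bloch-Wigner dilogarithm and [z = i sqrt 3 u].  The four terms
containing [beta], together with [- 2 Cl2 (PI - 4 alpha)], form
[2 D(z) + 2 D(- z) = D(z ^ 2)], which contains only multiples of [alpha].  What
is left is a relation in the field [Q(sqrt (-2))]: it follows from
[D(w v) + D(- w / v ^ 2) + D(- v / w ^ 2) = 0], where [w + v = 1], at
[w = i / sqrt 2], and from the duplication formula for [Lob].  Each functional
equation is proved along a curve: its derivative vanishes because of
multiplicative relations between the sines of the angles, and it is trivial at
one end of the curve. *)

Require Import Defs.
From Stdlib Require Import Reals Lra Lia.
From Coquelicot Require Import Coquelicot.
Open Scope R_scope.

(* Coquelicot's lemmas leave equations at types such as [AbelianGroup.sort _],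
   which [ring] and [field] reject. *)
Ltac eq_R := match goal with |- @eq _ ?a ?b => change (@eq R a b) end.

(** * Partial sums of the sine series and continuity of [Cl2] *)

Lemma INR_S_pos (n : nat) : 0 < INR (S n).
Proof. apply lt_0_INR; lia. Qed.

Lemma is_derive_continuity_pt (f : R -> R) (x l : R) :
  is_derive f x l -> continuity_pt f x.
Proof.
intros H; apply derivable_continuous_pt; exists l; now apply is_derive_Reals.
Qed.

Definition sin_partial (n : nat) (x : R) : R :=
  sum_n (fun k => sin (INR (S k) * x) / INR (S k) ^ 2) n.

Definition cos_partial (n : nat) (x : R) : R :=
  sum_n (fun k => cos (INR (S k) * x) / INR (S k)) n.

(** Telescoping: a term of index y + 1 is at most 1 / (y + 1)^2 <= 1 / y - 1 / (y + 1). The bound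
    does not depend on x, so the convergence is uniform on any set. *)
Lemma sin_partial_tail (n k : nat) (x : R) :
  Rabs (sin_partial (n + k) x - sin_partial n x)
    <= / INR (S n) - / INR (S (n + k)).
Proof.
induction k as [|k IH].
- rewrite Nat.add_0_r, Rminus_diag, Rabs_R0; lra.
- rewrite Nat.add_succ_r.
  unfold sin_partial in *; rewrite sum_Sn.
  change plus with Rplus.
  set (u := sum_n _ (n + k)) in *; set (v := sum_n _ n) in *.
  rewrite (S_INR (S (n + k))).
  pose proof (INR_S_pos (n + k)) as Hy.
  set (y := INR (S (n + k))) in *.
  assert (Hb : Rabs (sin ((y + 1) * x) / (y + 1) ^ 2) <= / y - / (y + 1)).
  { assert (H2 : 0 < (y + 1) ^ 2) by (apply pow_lt; lra).
    unfold Rdiv; rewrite Rabs_mult, (Rabs_pos_eq (/ _)) by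
      (apply Rlt_le, Rinv_0_lt_compat, H2).
    apply Rle_trans with (1 * / (y + 1) ^ 2).
    - apply Rmult_le_compat_r; [apply Rlt_le, Rinv_0_lt_compat, H2|].
      apply Rabs_le; generalize (SIN_bound ((y + 1) * x)); lra.
    - apply Rminus_le_0.
      replace (_ - _) with (/ (y * (y + 1) ^ 2)) by (field; lra).
      apply Rlt_le, Rinv_0_lt_compat, Rmult_lt_0_compat; assumption. }
  replace (_ - v) with ((u - v) + sin ((y + 1) * x) / (y + 1) ^ 2) by ring.
  eapply Rle_trans; [apply Rabs_triang|]; lra.
Qed.

Lemma sin_partial_CVU (D : R -> Prop) : CVU_dom sin_partial D.
Proof.
apply CVU_dom_cauchy; intros eps.
destruct (archimed_cor1 eps (cond_pos eps)) as [N [HN HN0]].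
assert (Hmain : forall n m x, (N <= n)%nat -> (n <= m)%nat ->
  Rabs (sin_partial m x - sin_partial n x) < eps).
{ intros n m x Hn Hm.
  replace m with (n + (m - n))%nat by lia.
  eapply Rle_lt_trans; [apply sin_partial_tail|].
  pose proof (Rinv_0_lt_compat _ (INR_S_pos (n + (m - n)))).
  assert (/ INR (S n) <= / INR N).
  { apply Rinv_le_contravar; [apply lt_0_INR; lia | apply le_INR; lia]. }
  lra. }
exists N; intros n m x _ Hn Hm.
destruct (Nat.le_ge_cases n m).
- rewrite Rabs_minus_sym; auto.
- auto.
Qed.

Lemma is_derive_sin_partial (n : nat) (x : R) :
  is_derive (sin_partial n) x (cos_partial n x).
Proof.
unfold sin_partial, cos_partial.
apply (is_derive_sum_n (fun k y => sin (INR (S k) * y) / INR (S k) ^ 2)).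
intros k _; pose proof (INR_S_pos k); set (y := INR (S k)) in *.
auto_derive; trivial; field; lra.
Qed.

Lemma is_derive_cos_partial (n : nat) (x : R) :
  is_derive (cos_partial n) x (- sum_n (fun k => sin (INR (S k) * x)) n).
Proof.
unfold cos_partial.
replace (- sum_n _ n) with (sum_n (fun k => - sin (INR (S k) * x)) n).
- apply (is_derive_sum_n (fun k y => cos (INR (S k) * y) / INR (S k))).
  intros k _; pose proof (INR_S_pos k); set (y := INR (S k)) in *.
  auto_derive; trivial; field; lra.
- induction n as [|n IH]; [now rewrite !sum_O|].
  rewrite !sum_Sn, IH; change plus with Rplus; eq_R; ring.
Qed.

(** A uniform limit of continuous functions. Multiples of 2 PI, where the derivative blows up, are
    included; the functional equations below are evaluated at such points. *)
Lemma Cl2_continuous (x : R) : continuity_pt Cl2 x.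
Proof.
apply (CVU_cont_open sin_partial (fun _ => True)); trivial.
- intros y _; apply filter_true.
- apply sin_partial_CVU.
- intros n y _; eapply is_derive_continuity_pt, is_derive_sin_partial.
Qed.

(** * Convergence of the cosine series and the derivative of [Cl2] *)

(** Multiplied by 2 sin(x / 2), each term becomes a difference of cosines and the sum telescopes. *)
Lemma sum_sin_closed (n : nat) (x : R) : sin (x / 2) <> 0 ->
  sum_n (fun k => sin (INR (S k) * x)) n
    = (cos (x / 2) - cos ((INR (S n) + / 2) * x)) / (2 * sin (x / 2)).
Proof.
intros Hs.
assert (Hprod : forall a b, 2 * sin a * sin b = cos (a - b) - cos (a + b)).
{ intros a b; rewrite cos_minus, cos_plus; ring. }
apply (Rmult_eq_reg_r (2 * sin (x / 2))); [|lra].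
replace (_ / _ * _) with (cos (x / 2) - cos ((INR (S n) + / 2) * x))
  by (field; lra).
induction n as [|n IH].
- rewrite sum_O; simpl INR.
  replace (sin (1 * x) * (2 * sin (x / 2))) with (2 * sin (1 * x) * sin (x / 2))
    by ring.
  rewrite Hprod; f_equal; f_equal; field.
- rewrite sum_Sn; change plus with Rplus.
  rewrite Rmult_plus_distr_r, IH.
  replace (sin (INR (S (S n)) * x) * (2 * sin (x / 2)))
    with (2 * sin (INR (S (S n)) * x) * sin (x / 2)) by ring.
  rewrite Hprod, (S_INR (S n)).
  replace ((INR (S n) + 1) * x - x / 2) with ((INR (S n) + / 2) * x) by field.
  replace ((INR (S n) + 1) * x + x / 2) with ((INR (S n) + 1 + / 2) * x) by field.
  ring.
Qed.

(** Both g + f and g - f are nondecreasing. Unlike a constant bound on the derivative, this keeps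
    the decay obtained by integrating x^n over [0, 1]. *)
Lemma increment_le_increment (f g df dg : R -> R) (a b : R) : a <= b ->
  (forall x, a <= x <= b -> is_derive f x (df x)) ->
  (forall x, a <= x <= b -> is_derive g x (dg x)) ->
  (forall x, a <= x <= b -> Rabs (df x) <= dg x) ->
  Rabs (f b - f a) <= g b - g a.
Proof.
intros Hab Hf Hg Hle.
assert (Hmon : forall s, Rabs s = 1 -> 0 <= (g b + s * f b) - (g a + s * f a)).
{ intros s Hs.
  assert (Hd : forall x, a <= x <= b ->
    is_derive (fun y => g y + s * f y) x (dg x + s * df x)).
  { intros x Hx; apply @is_derive_plus; [auto|].
    apply is_derive_scal; auto. }
  destruct (MVT_gen (fun y => g y + s * f y) a b (fun x => dg x + s * df x))
    as [c [Hc ->]].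
  - rewrite Rmin_left, Rmax_right by lra; intros x Hx; apply Hd; lra.
  - rewrite Rmin_left, Rmax_right by lra; intros x Hx.
    eapply is_derive_continuity_pt, Hd; lra.
  - rewrite Rmin_left, Rmax_right in Hc by lra.
    apply Rmult_le_pos; [|lra].
    specialize (Hle c Hc).
    assert (Rabs (s * df c) <= dg c) by (rewrite Rabs_mult, Hs, Rmult_1_l; auto).
    assert (- Rabs (s * df c) <= s * df c)
      by (rewrite <- Rabs_Ropp; generalize (Rle_abs (- (s * df c))); lra).
    lra. }
pose proof (Hmon 1 Rabs_R1).
pose proof (Hmon (-1) ltac:(rewrite Rabs_left; lra)).
apply Rabs_le; lra.
Qed.

Lemma cos_INR_PI (n : nat) : cos (INR n * PI) = (-1) ^ n.
Proof.
induction n as [|n IH]; [simpl; rewrite Rmult_0_l; apply cos_0|].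
rewrite S_INR, Rmult_plus_distr_r, Rmult_1_l, neg_cos, IH; simpl; ring.
Qed.

(** The polynomial is minus the Taylor polynomial of ln(1 + y) at 0, so its derivative is a
    geometric sum that cancels all but one power. *)
Lemma is_derive_log_remainder (n : nat) (x : R) : 0 <= x ->
  is_derive
    (fun y => ln (1 + y) + sum_n (fun k => (-1) ^ S k * y ^ S k / INR (S k)) n) x
    ((- x) ^ S n / (1 + x)).
Proof.
intros Hx.
replace ((- x) ^ S n / (1 + x))
  with (/ (1 + x) + sum_n (fun k => (-1) ^ S k * x ^ k) n).
- apply @is_derive_plus; [auto_derive; [lra | field; lra]|].
  apply (is_derive_sum_n (fun k y => (-1) ^ S k * y ^ S k / INR (S k))).
  intros k _; pose proof (INR_S_pos k).
  set (c := (-1) ^ S k).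
  auto_derive; trivial.
  change (match k with 0%nat => 1 | S _ => INR k + 1 end) with (INR (S k)).
  simpl Init.Nat.pred; field; lra.
- induction n as [|n IH].
  + rewrite sum_O; simpl; eq_R; field; lra.
  + rewrite sum_Sn; change plus with Rplus; rewrite <- Rplus_assoc, IH.
    replace (- x) with (-1 * x) by ring; rewrite !Rpow_mult_distr.
    simpl; eq_R; field; lra.
Qed.

(** At PI the cosine sum is a partial sum of the series of - ln 2. The logarithmic remainder
    vanishes at 0 and its derivative is at most x^(n+1) on [0, 1], whence 1 / (n + 2). This value
    fixes the constant of integration in [cos_partial_bound]. *)
Lemma alternating_harmonic_bound (n : nat) :
  Rabs (cos_partial n PI + ln 2) <= / INR (S (S n)).
Proof.
pose (f := fun y =>
  ln (1 + y) + sum_n (fun k => (-1) ^ S k * y ^ S k / INR (S k)) n).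
pose (g := fun y => y ^ S (S n) / INR (S (S n))).
assert (Hf0 : f 0 = 0).
{ unfold f; rewrite Rplus_0_r, ln_1, Rplus_0_l.
  rewrite (sum_n_ext _ (fun _ => 0)) by (intros k; simpl; unfold Rdiv; ring).
  rewrite sum_n_const; ring. }
assert (Hf1 : f 1 = cos_partial n PI + ln 2).
{ unfold f, cos_partial; rewrite Rplus_comm; f_equal.
  apply sum_n_ext; intros k; rewrite cos_INR_PI, pow1; f_equal; ring. }
rewrite <- Hf1; replace (f 1) with (f 1 - f 0) by (rewrite Hf0; ring).
replace (/ INR (S (S n))) with (g 1 - g 0)
  by (unfold g; rewrite pow1, pow_i by lia; unfold Rdiv; ring).
apply increment_le_increment with
  (df := fun x => (- x) ^ S n / (1 + x)) (dg := fun x => x ^ S n); [lra|..].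
- intros x Hx; apply is_derive_log_remainder; lra.
- intros x Hx; unfold g.
  pose proof (INR_S_pos (S n)).
  change (x ^ S n) with (x ^ Nat.pred (S (S n))).
  set (m := S (S n)) in *; clearbody m.
  auto_derive; trivial; field; lra.
- intros x Hx.
  unfold Rdiv; rewrite Rabs_mult, <- RPow_abs, Rabs_Ropp, (Rabs_pos_eq x) by lra.
  rewrite Rabs_pos_eq by (apply Rlt_le, Rinv_0_lt_compat; lra).
  rewrite <- (Rmult_1_r (x ^ S n)) at 2.
  apply Rmult_le_compat_l; [apply pow_le; lra|].
  rewrite <- Rinv_1; apply Rinv_le_contravar; lra.
Qed.

(* [cos_partial n + ln (2 sin (x / 2))] has the oscillating derivative
   [cos (m x) / (2 sin (x / 2))], m = n + 3/2; integrating it by parts gains the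
   factor 1 / m. *)
Lemma is_derive_cos_partial_remainder (n : nat) (x : R) :
  let m := INR (S n) + / 2 in
  0 < sin (x / 2) ->
  is_derive
    (fun y => cos_partial n y + (ln (2 * sin (y / 2))
      - sin (m * y) / (2 * m * sin (y / 2)))) x
    (sin (m * x) * cos (x / 2) / (4 * m * sin (x / 2) ^ 2)).
Proof.
intros m Hs.
assert (Hm : 0 < m) by (pose proof (INR_S_pos n); unfold m; lra).
replace (_ / _) with (- sum_n (fun k => sin (INR (S k) * x)) n
  + (cos (x / 2) / (2 * sin (x / 2))
     - (cos (m * x) / (2 * sin (x / 2))
        - sin (m * x) * cos (x / 2) / (4 * m * sin (x / 2) ^ 2)))).
- apply @is_derive_plus; [apply is_derive_cos_partial|].
  clearbody m; auto_derive.
  + repeat split; try (apply Rgt_not_eq; repeat apply Rmult_lt_0_compat);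
    unfold Rdiv in *; try lra.
  + unfold Rdiv in *; field; lra.
- rewrite sum_sin_closed by lra; fold m; field; lra.
Qed.

Lemma sin_half_ge (d x : R) : 0 < d -> d <= x <= 2 * PI - d ->
  sin (d / 2) <= sin (x / 2).
Proof.
intros Hd Hx.
pose proof PI_RGT_0.
destruct (Rle_dec x PI).
- apply sin_incr_1; lra.
- rewrite <- (sin_PI_x (x / 2)); apply sin_incr_1; lra.
Qed.

(** The corrected remainder [e] is bounded at PI and then carried to x by its derivative, which is
    of order 1 / m. In the constant, 2 comes from [e PI], PI / s^2 from the variation between PI and
    x, and 1 / s from the oscillating correction at x. *)
Lemma cos_partial_bound (d x : R) (n : nat) : 0 < d -> d <= x <= 2 * PI - d ->
  Rabs (cos_partial n x + ln (2 * sin (x / 2)))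
    <= (2 + PI / sin (d / 2) ^ 2 + / sin (d / 2)) / INR (S n).
Proof.
intros Hd Hx.
pose proof PI_RGT_0 as HPI.
set (s := sin (d / 2)).
assert (Hs : 0 < s) by (apply sin_gt_0; lra).
assert (Hge : forall y, d <= y <= 2 * PI - d -> s <= sin (y / 2))
  by (intros; now apply sin_half_ge).
pose proof (INR_S_pos n) as HN.
set (m := INR (S n) + / 2).
assert (Hm : 0 < m) by (unfold m; lra).
assert (Hm1 : / m <= / INR (S n)) by (apply Rinv_le_contravar; unfold m; lra).
pose (e := fun y => cos_partial n y + (ln (2 * sin (y / 2))
  - sin (m * y) / (2 * m * sin (y / 2)))).
assert (Hosc : forall y, d <= y <= 2 * PI - d ->
  Rabs (sin (m * y) / (2 * m * sin (y / 2))) <= / s * / m).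
{ intros y Hy; specialize (Hge y Hy).
  unfold Rdiv; rewrite Rabs_mult.
  assert (0 < s * m) by (apply Rmult_lt_0_compat; lra).
  assert (s * m <= 2 * m * sin (y / 2)).
  { replace (2 * m * sin (y / 2)) with (m * (2 * sin (y / 2))) by ring.
    rewrite Rmult_comm; apply Rmult_le_compat_l; lra. }
  rewrite (Rabs_pos_eq (/ _))
    by (apply Rlt_le, Rinv_0_lt_compat; unfold Rdiv in *; lra).
  rewrite <- Rinv_mult, <- (Rmult_1_l (/ (s * m))).
  apply Rmult_le_compat; [apply Rabs_pos | | |].
  - apply Rlt_le, Rinv_0_lt_compat; unfold Rdiv in *; lra.
  - apply Rabs_le; generalize (SIN_bound (m * y)); lra.
  - now apply Rinv_le_contravar. }
assert (HePI : Rabs (e PI) <= 2 * / INR (S n)).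
{ unfold e; rewrite sin_PI2, !Rmult_1_r.
  replace (cos_partial n PI + (ln 2 - sin (m * PI) / (2 * m)))
    with ((cos_partial n PI + ln 2) + - (sin (m * PI) / (2 * m))) by ring.
  eapply Rle_trans; [apply Rabs_triang|].
  rewrite Rabs_Ropp.
  pose proof (alternating_harmonic_bound n).
  assert (/ INR (S (S n)) <= / INR (S n))
    by (apply Rinv_le_contravar; [lra | apply le_INR; lia]).
  assert (Rabs (sin (m * PI) / (2 * m)) <= / m).
  { unfold Rdiv; rewrite Rabs_mult, (Rabs_pos_eq (/ _))
      by (apply Rlt_le, Rinv_0_lt_compat; lra).
    rewrite <- (Rmult_1_l (/ m)).
    apply Rmult_le_compat; [apply Rabs_pos | | |].
    - apply Rlt_le, Rinv_0_lt_compat; lra.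
    - apply Rabs_le; generalize (SIN_bound (m * PI)); lra.
    - apply Rinv_le_contravar; lra. }
  lra. }
assert (Hs2 : 0 < s ^ 2) by (apply pow_lt, Hs).
assert (Hvar : Rabs (e x - e PI) <= PI / s ^ 2 * / m).
{ apply Rle_trans with (/ s ^ 2 * / m * Rabs (x - PI)).
  - apply bounded_variation with
      (dh := fun y => sin (m * y) * cos (y / 2) / (4 * m * sin (y / 2) ^ 2)).
    intros t Ht.
    assert (Hdt : d <= t <= 2 * PI - d).
    { apply Rabs_le_between in Ht.
      assert (Rabs (x - PI) <= PI - d) by (apply Rabs_le; lra); lra. }
    specialize (Hge t Hdt).
    split; [apply is_derive_cos_partial_remainder; lra|].
    unfold Rdiv at 1; rewrite !Rabs_mult.
    assert (Hst : s ^ 2 <= sin (t / 2) ^ 2) by (apply pow_incr; lra).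
    assert (H0 : 0 < s ^ 2 * m) by (apply Rmult_lt_0_compat; lra).
    assert (H1 : s ^ 2 * m <= 4 * m * sin (t / 2) ^ 2).
    { replace (4 * m * sin (t / 2) ^ 2) with (m * (4 * sin (t / 2) ^ 2)) by ring.
      rewrite Rmult_comm; apply Rmult_le_compat_l; lra. }
    rewrite (Rabs_pos_eq (/ _)) by (apply Rlt_le, Rinv_0_lt_compat; lra).
    rewrite <- Rinv_mult, <- (Rmult_1_l (/ (s ^ 2 * m))).
    apply Rmult_le_compat.
    + apply Rmult_le_pos; apply Rabs_pos.
    + apply Rlt_le, Rinv_0_lt_compat; lra.
    + rewrite <- (Rmult_1_l 1); apply Rmult_le_compat; try apply Rabs_pos;
        apply Rabs_le;
        [generalize (SIN_bound (m * t)) | generalize (COS_bound (t / 2))]; lra.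
    + now apply Rinv_le_contravar.
  - replace (PI / s ^ 2 * / m) with (/ s ^ 2 * / m * PI) by (field; lra).
    apply Rmult_le_compat_l.
    + apply Rlt_le, Rmult_lt_0_compat; apply Rinv_0_lt_compat; lra.
    + apply Rabs_le; lra. }
specialize (Hosc x Hx).
assert (Hmono : forall a, 0 <= a -> a * / m <= a * / INR (S n))
  by (intros; now apply Rmult_le_compat_l).
assert (0 <= PI / s ^ 2) by (apply Rlt_le, Rdiv_lt_0_compat; lra).
assert (0 <= / s) by (apply Rlt_le, Rinv_0_lt_compat; lra).
replace (cos_partial n x + ln (2 * sin (x / 2)))
  with (e PI + (e x - e PI) + sin (m * x) / (2 * m * sin (x / 2)))
  by (unfold e; ring).
eapply Rle_trans; [apply Rabs_triang|].
eapply Rle_trans; [apply Rplus_le_compat_r, Rabs_triang|].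
replace (_ / INR (S n)) with
  (2 * / INR (S n) + PI / s ^ 2 * / INR (S n) + / s * / INR (S n))
  by (unfold Rdiv; ring).
pose proof (Hmono (PI / s ^ 2)); pose proof (Hmono (/ s)); lra.
Qed.

(** Termwise differentiation: on (d, 2 PI - d), a neighbourhood of x, the differentiated series
    converges uniformly. *)
Lemma is_derive_Cl2 (x : R) : 0 < x < 2 * PI ->
  is_derive Cl2 x (- ln (2 * sin (x / 2))).
Proof.
intros Hx.
pose (d := Rmin x (2 * PI - x) / 2).
assert (Hd : 0 < d).
{ assert (0 < Rmin x (2 * PI - x)) by (apply Rmin_glb_lt; lra).
  unfold d; lra. }
assert (Hdx : d < x < 2 * PI - d).
{ unfold d in *.
  pose proof (Rmin_l x (2 * PI - x)); pose proof (Rmin_r x (2 * PI - x)); lra. }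
set (C := 2 + PI / sin (d / 2) ^ 2 + / sin (d / 2)).
assert (HC : 0 < C).
{ pose proof PI_RGT_0.
  assert (Hs : 0 < sin (d / 2)) by (apply sin_gt_0; lra).
  pose proof (Rinv_0_lt_compat _ Hs).
  unfold C.
  assert (0 < PI / sin (d / 2) ^ 2)
    by (apply Rdiv_lt_0_compat; [lra | now apply pow_lt]).
  lra. }
assert (Hsmall : forall eps : posreal, exists N, forall n y, (N <= n)%nat ->
  d < y < 2 * PI - d -> Rabs (cos_partial n y + ln (2 * sin (y / 2))) < eps).
{ intros eps.
  destruct (archimed_cor1 (eps / C)) as [N [HN HN0]].
  { apply Rdiv_lt_0_compat; [apply cond_pos | exact HC]. }
  exists N; intros n y Hn Hy.
  eapply Rle_lt_trans; [apply cos_partial_bound with (d := d); lra|].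
  fold C.
  apply Rle_lt_trans with (C * / INR N).
  - apply Rmult_le_compat_l; [lra|].
    apply Rinv_le_contravar; [apply lt_0_INR; lia | apply le_INR; lia].
  - apply Rmult_lt_compat_l with (r := C) in HN; [|exact HC].
    replace (C * (eps / C)) with (pos eps) in HN by (field; lra); exact HN. }
assert (Hlim : forall y, d < y < 2 * PI - d ->
  Lim_seq (fun n => cos_partial n y) = - ln (2 * sin (y / 2)) :> Rbar).
{ intros y Hy; apply is_lim_seq_unique, is_lim_seq_spec.
  intros eps; destruct (Hsmall eps) as [N HN]; exists N; intros n Hn.
  replace (_ - _) with (cos_partial n y + ln (2 * sin (y / 2))) by ring; auto. }
assert (HD : forall n y, Derive (sin_partial n) y = cos_partial n y)
  by (intros; apply is_derive_unique, is_derive_sin_partial).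
replace (- ln (2 * sin (x / 2)))
  with (real (Lim_seq (fun n => Derive (sin_partial n) x)))
  by (rewrite (Lim_seq_ext _ (fun n => cos_partial n x)), (Hlim x Hdx) by auto;
      reflexivity).
apply (CVU_Derive sin_partial (fun y => d < y < 2 * PI - d)); trivial.
- apply open_and; [apply open_gt | apply open_lt].
- intros a b y Ha Hb Hy; lra.
- apply sin_partial_CVU.
- intros n y _; eexists; apply is_derive_sin_partial.
- intros n y _.
  apply continuity_pt_ext with (f := cos_partial n); [intros; now rewrite HD|].
  eapply is_derive_continuity_pt, is_derive_cos_partial.
- intros eps; destruct (Hsmall eps) as [N HN]; exists N; intros n Hn y Hy.
  rewrite HD, (Lim_seq_ext _ (fun n => cos_partial n y)), (Hlim y Hy) by auto.
  simpl real; unfold Rminus; rewrite Ropp_involutive; auto.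
Qed.

(** * The Lobachevsky function: symmetries, derivative, duplication *)

Definition Lob (x : R) : R := Cl2 (2 * x) / 2.

(** Termwise comparison; c = -1 gives oddness and c = 1 gives periodicity. *)
Lemma Cl2_scal (x y c : R) :
  (forall n, sin (INR n * y) = c * sin (INR n * x)) -> Cl2 y = c * Cl2 x.
Proof.
intros H; unfold Cl2; rewrite <- Series_scal_l.
apply Series_ext; intros n; rewrite H; unfold Rdiv; ring.
Qed.

Lemma Lob_opp (x : R) : Lob (- x) = - Lob x.
Proof.
unfold Lob; rewrite (Cl2_scal (2 * x) (2 * - x) (-1)); [field|].
intros n; rewrite <- Ropp_mult_distr_r, <- Ropp_mult_distr_r, sin_neg; ring.
Qed.

Lemma sin_plus_IZR_2PI (x : R) (k : Z) : sin (x + IZR k * (2 * PI)) = sin x.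
Proof.
rewrite sin_plus, (Rmult_comm (IZR k)), (Rmult_comm 2), Rmult_assoc.
rewrite <- mult_IZR, (Rmult_comm PI).
rewrite (sin_eq_0_1 (IZR (2 * k) * PI)) by (eexists; reflexivity).
rewrite mult_IZR, Rmult_assoc, cos_2a_sin.
rewrite (sin_eq_0_1 (IZR k * PI)) by (eexists; reflexivity).
ring.
Qed.

Lemma Lob_plus_IZR_PI (x : R) (k : Z) : Lob (x + IZR k * PI) = Lob x.
Proof.
unfold Lob; rewrite (Cl2_scal (2 * x) (2 * (x + IZR k * PI)) 1);
  [field|].
intros n; rewrite Rmult_1_l, INR_IZR_INZ.
replace (IZR (Z.of_nat n) * (2 * (x + IZR k * PI)))
  with (IZR (Z.of_nat n) * (2 * x) + IZR (Z.of_nat n * k) * (2 * PI))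
  by (rewrite mult_IZR; ring).
apply sin_plus_IZR_2PI.
Qed.

Lemma Lob_0 : Lob 0 = 0.
Proof. generalize (Lob_opp 0); rewrite Ropp_0; lra. Qed.

Lemma Lob_PI2 : Lob (PI / 2) = 0.
Proof.
generalize (Lob_opp (PI / 2)) (Lob_plus_IZR_PI (- (PI / 2)) 1).
replace (- (PI / 2) + 1 * PI) with (PI / 2) by field; lra.
Qed.

Lemma is_derive_Lob (x : R) : 0 < x < PI -> is_derive Lob x (- ln (2 * sin x)).
Proof.
intros Hx; unfold Lob.
pose proof (is_derive_Cl2 (2 * x) ltac:(lra)) as H.
replace (2 * x / 2) with x in H by field.
replace (- ln (2 * sin x)) with (/ 2 * (2 * - ln (2 * sin x))) by field.
apply (is_derive_ext (fun y => / 2 * Cl2 (2 * y))); [intros; eq_R; field|].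
apply is_derive_scal, (is_derive_comp Cl2 (fun y => 2 * y)); [exact H|].
auto_derive; trivial; ring.
Qed.

Lemma is_derive_Lob_comp (u : R -> R) (x du : R) :
  is_derive u x du -> 0 < u x < PI ->
  is_derive (fun y => Lob (u y)) x (- (du * ln (2 * sin (u x)))).
Proof.
intros Hu Hx.
replace (- (du * _)) with (du * - ln (2 * sin (u x))) by ring.
apply (is_derive_comp Lob u); [now apply is_derive_Lob | exact Hu].
Qed.

Lemma Lob_continuous (x : R) : continuous Lob x.
Proof.
unfold Lob, Rdiv.
apply (continuous_mult (fun y => Cl2 (2 * y)) (fun _ => / 2));
  [|apply continuous_const].
apply (continuous_comp (fun y => 2 * y) Cl2).
- apply (continuous_mult (fun _ => 2) (fun y => y));
    [apply continuous_const | apply continuous_id].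
- apply continuity_pt_filterlim, Cl2_continuous.
Qed.

Lemma Lob_comp_continuous (u : R -> R) (x : R) :
  continuous u x -> continuous (fun y => Lob (u y)) x.
Proof. intros H; apply continuous_comp; [exact H | apply Lob_continuous]. Qed.

(** Only continuity is asked at the ends, where the argument of some [Lob] may be a multiple of PI
    and differentiability fails. *)
Lemma constant_of_derive_0 (f : R -> R) (a b : R) : a <= b ->
  (forall x, a < x < b -> is_derive f x 0) ->
  (forall x, a <= x <= b -> continuous f x) -> f b = f a.
Proof.
intros Hab Hd Hc.
destruct (MVT_gen f a b (fun _ => 0)) as [c [_ H]].
- rewrite Rmin_left, Rmax_right by lra; exact Hd.
- rewrite Rmin_left, Rmax_right by lra; intros x Hx.
  now apply continuity_pt_filterlim, Hc.
- lra.
Qed.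

(** The derivative of the difference vanishes because sin 2y = 2 sin y cos y. At the base point PI /
    4 the two halves cancel and [Lob (PI / 2)] is 0. *)
Lemma Lob_double (x : R) : 0 < x < PI / 2 ->
  Lob (2 * x) = 2 * Lob x - 2 * Lob (PI / 2 - x).
Proof.
intros Hx; pose proof PI_RGT_0.
pose (g := fun y => Lob (2 * y) - 2 * Lob y + 2 * Lob (PI / 2 - y)).
assert (Hd : forall y, 0 < y < PI / 2 -> is_derive g y 0).
{ intros y Hy.
  assert (Hs : 0 < sin y) by (apply sin_gt_0; lra).
  assert (Hc : 0 < cos y) by (apply cos_gt_0; lra).
  replace 0 with (- (2 * ln (2 * sin (2 * y))) - 2 * - (1 * ln (2 * sin y))
    + 2 * - ((-1) * ln (2 * sin (PI / 2 - y)))).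
  - apply @is_derive_plus; [apply @is_derive_minus|].
    + apply (is_derive_Lob_comp (fun y => 2 * y)); [auto_derive; trivial; ring | lra].
    + apply is_derive_scal, (is_derive_Lob_comp (fun y => y));
        [apply @is_derive_id | lra].
    + apply is_derive_scal, (is_derive_Lob_comp (fun y => PI / 2 - y));
        [auto_derive; trivial; ring | lra].
  - rewrite sin_shift, sin_2a.
    replace (2 * (2 * sin y * cos y)) with ((2 * sin y) * (2 * cos y)) by ring.
    rewrite ln_mult by lra; ring. }
assert (Hg : forall y, 0 < y < PI / 2 -> continuous g y).
{ intros y Hy; apply @ex_derive_continuous; exists 0; auto. }
assert (E : g x = g (PI / 4)).
{ destruct (Rle_dec x (PI / 4)).
  - symmetry; apply constant_of_derive_0; [lra | |];
      intros y Hy; [apply Hd | apply Hg]; lra.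
  - apply constant_of_derive_0; [lra | |];
      intros y Hy; [apply Hd | apply Hg]; lra. }
unfold g in E.
replace (2 * (PI / 4)) with (PI / 2) in E by field.
replace (PI / 2 - PI / 4) with (PI / 4) in E by field.
rewrite Lob_PI2 in E; lra.
Qed.

(** * Functional equations of [Lob] along arctangent curves *)

Lemma sin_atan_mul (x : R) : sin (atan x) = x * cos (atan x).
Proof.
pose proof (atan_bound x).
rewrite <- (tan_atan x) at 2; unfold tan; field.
apply Rgt_not_eq, cos_gt_0; lra.
Qed.

Lemma cos_atan_pos (x : R) : 0 < cos (atan x).
Proof. pose proof (atan_bound x); apply cos_gt_0; lra. Qed.

Lemma cos_atan_sqr (x : R) : cos (atan x) ^ 2 * (1 + x ^ 2) = 1.
Proof.
generalize (sin2_cos2 (atan x)); rewrite sin_atan_mul; unfold Rsqr; lra.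
Qed.

Lemma is_derive_add_Lob (f u : R -> R) (c x df du : R) :
  is_derive f x df -> is_derive u x du -> 0 < u x < PI ->
  is_derive (fun y => f y + c * Lob (u y)) x
    (df - c * (du * ln (2 * sin (u x)))).
Proof.
intros Hf Hu Hx.
replace (_ - _) with (df + c * - (du * ln (2 * sin (u x)))) by ring.
apply @is_derive_plus; [exact Hf|].
now apply is_derive_scal, is_derive_Lob_comp.
Qed.

Lemma continuous_add_Lob (f u : R -> R) (c x : R) :
  continuous f x -> continuous u x ->
  continuous (fun y => f y + c * Lob (u y)) x.
Proof.
intros Hf Hu.
apply (continuous_plus f (fun y => c * Lob (u y))); [exact Hf|].
apply (continuous_mult (fun _ => c) (fun y => Lob (u y)));
  [apply continuous_const | now apply Lob_comp_continuous].
Qed.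

(** Peels the last summand off a left-nested sum, down to a constant; this is why the sums below
    start with 0. The range condition 0 < u x < PI of each angle is left to the caller. *)
Ltac derive_Lob tac :=
  match goal with
  | |- is_derive (fun y => @?f y + ?c * Lob (@?u y)) ?x _ =>
      eapply (is_derive_add_Lob f u c x);
      [derive_Lob tac | auto_derive; [tac | reflexivity] | ]
  | |- is_derive (fun _ => ?c) ?x _ => apply (is_derive_const c x)
  end.

Ltac continuous_Lob tac :=
  match goal with
  | |- continuous (fun y => @?f y + ?c * Lob (@?u y)) ?x =>
      apply (continuous_add_Lob f u c x);
      [continuous_Lob tac | apply @ex_derive_continuous; auto_derive; tac]
  | |- continuous (fun _ => ?c) ?x => apply (continuous_const c x)
  end.

Lemma is_derive_congr (f : R -> R) (x l l' : R) :
  is_derive f x l -> l = l' -> is_derive f x l'.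
Proof. intros H E; now rewrite <- E. Qed.

(* Up to duplication, this is [D(w v) + D(- w / v ^ 2) + D(- v / w ^ 2) = 0],
   where [w + v = 1], on the line [w = i r].  Both partial derivatives with
   respect to [p] and [q] vanish along the curve [tan q = tan p ^ 3]: the
   logarithms of all the sines are combinations of those of [2], [r],
   [1 - r ^ 2], [cos p] and [cos q]. *)
Lemma Lob_cubic_relation (r : R) : 0 <= r < 1 ->
  let p := atan r in let q := atan (r ^ 3) in
  2 * Lob (p + q) - Lob (2 * p) / 2 - Lob (2 * q) / 2 - Lob (PI / 2 - 2 * p)
    + Lob (PI / 2 - (p + q)) - Lob (p - q) = 0.
Proof.
intros Hr.
pose (q := fun y => atan (y ^ 3)).
pose (f := fun y => 0 + 2 * Lob (atan y + q y) + - / 2 * Lob (2 * atan y)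
  + - / 2 * Lob (2 * q y) + -1 * Lob (PI / 2 - 2 * atan y)
  + 1 * Lob (PI / 2 - (atan y + q y)) + -1 * Lob (atan y - q y)).
assert (Hq : forall y, ex_derive q y).
{ intros y; unfold q; auto_derive; trivial. }
assert (Hc : forall y, continuous f y).
{ intros y; unfold f; continuous_Lob auto. }
assert (Hd : forall y, 0 < y < r -> is_derive f y 0).
{ intros y Hy.
  (* As y < 1, p < PI / 4 and 0 < q < p, which puts all six angles in (0, PI). *)
  assert (H1 : 0 < atan y < PI / 4).
  { rewrite <- atan_0, <- atan_1; split; apply atan_increasing; lra. }
  assert (Hy2 : 0 < (1 - y) * (1 + y)) by (apply Rmult_lt_0_compat; lra).
  assert (H2 : 0 < q y < atan y).
  { assert (0 < y ^ 3) by (apply pow_lt; lra).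
    assert (0 < y * ((1 - y) * (1 + y))) by (apply Rmult_lt_0_compat; lra).
    unfold q; rewrite <- atan_0 at 1; split; apply atan_increasing; lra. }
  eapply is_derive_congr; [unfold f; derive_Lob auto; lra|].
  change zero with 0.
  set (k := cos (atan y)); set (l := cos (q y)).
  assert (Hk : 0 < k) by apply cos_atan_pos.
  assert (Hl : 0 < l) by apply cos_atan_pos.
  assert (Hsk : sin (atan y) = y * k) by apply sin_atan_mul.
  assert (Hsl : sin (q y) = y ^ 3 * l) by apply sin_atan_mul.
  assert (Hk2 : k ^ 2 * (1 + y ^ 2) = 1) by apply cos_atan_sqr.
  (* This turns the factor 1 + y^2 in the sine and cosine of p + q into a power of cos p, so that
     every sine below is a monomial in 2, y, k, l and M. *)
  assert (Hw : 1 + y ^ 2 = / k * / k).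
  { apply (Rmult_eq_reg_l (k ^ 2)); [rewrite Hk2; field; lra|].
    apply pow_nonzero; lra. }
  assert (H1y : 0 < y) by lra.
  pose proof (Rinv_0_lt_compat _ Hk) as Hk'.
  set (M := (1 - y) * (1 + y)) in *.
  assert (L1 : ln (2 * sin (2 * atan y)) = 2 * ln 2 + ln y + 2 * ln k).
  { rewrite sin_2a, Hsk; fold k.
    replace (2 * (2 * (y * k) * k)) with (2 * 2 * y * k * k) by ring.
    rewrite !ln_mult by (repeat apply Rmult_lt_0_compat; lra); ring. }
  assert (L2 : ln (2 * sin (2 * q y)) = 2 * ln 2 + 3 * ln y + 2 * ln l).
  { rewrite sin_2a, Hsl; fold l.
    replace (2 * (2 * (y ^ 3 * l) * l)) with (2 * 2 * y * y * y * l * l) by ring.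
    rewrite !ln_mult by (repeat apply Rmult_lt_0_compat; lra); ring. }
  assert (L3 : ln (2 * sin (atan y + q y)) = ln 2 + ln y + ln l - ln k).
  { rewrite sin_plus, Hsk, Hsl; fold k l.
    replace (2 * _) with (2 * y * l * k * (1 + y ^ 2)) by ring; rewrite Hw.
    rewrite !ln_mult, !ln_Rinv by (repeat apply Rmult_lt_0_compat; lra); ring. }
  assert (L4 : ln (2 * sin (PI / 2 - 2 * atan y)) = ln 2 + 2 * ln k + ln M).
  { rewrite sin_shift, cos_2a, Hsk; fold k.
    replace (2 * _) with (2 * k * k * M) by (unfold M; ring).
    rewrite !ln_mult by (repeat apply Rmult_lt_0_compat; lra); ring. }
  assert (L5 : ln (2 * sin (PI / 2 - (atan y + q y)))
    = ln 2 + ln l - ln k + ln M).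
  { rewrite sin_shift, cos_plus, Hsk, Hsl; fold k l.
    replace (2 * _) with (2 * l * k * (1 + y ^ 2) * M) by (unfold M; ring).
    rewrite Hw.
    rewrite !ln_mult, !ln_Rinv by (repeat apply Rmult_lt_0_compat; lra); ring. }
  assert (L6 : ln (2 * sin (atan y - q y)) = ln 2 + ln y + ln k + ln l + ln M).
  { rewrite sin_minus, Hsk, Hsl; fold k l.
    replace (2 * _) with (2 * y * l * k * M) by (unfold M; ring).
    rewrite !ln_mult by (repeat apply Rmult_lt_0_compat; lra); ring. }
  rewrite L1, L2, L3, L4, L5, L6; field; nra. }
intros p q'.
assert (E : f r = f 0) by (apply constant_of_derive_0; auto; lra).
unfold f, q in E; rewrite pow_i, atan_0 in E by lia.
rewrite !Rmult_0_r, !Rplus_0_r, !Rminus_0_r, Lob_0, Lob_PI2 in E.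
fold p q' in E; lra.
Qed.

(* The relation [D(z) + D(- z) = D(z ^ 2) / 2] for the Bloch-Wigner dilogarithm
   at [z = t (c + i)], written with the angles of the three ideal tetrahedra:
   [arg z = phi], [arg (1 - z) = - A] and [arg (1 + z) = B]. *)
Lemma Lob_square_relation (c t : R) : 0 < c -> 0 <= t -> c * t < 1 ->
  let phi := atan (/ c) in
  let A := atan (t / (1 - c * t)) in let B := atan (t / (1 + c * t)) in
  2 * Lob phi + Lob A - Lob B - Lob (phi + A) - Lob (phi - B)
    - Lob (2 * phi) / 2 - Lob (A - B) / 2 + Lob (2 * phi + (A - B)) / 2 = 0.
Proof.
intros Hc Ht0 Htc phi.
pose (A := fun y => atan (y / (1 - c * y))).
pose (B := fun y => atan (y / (1 + c * y))).
pose (f := fun y => 0 + 1 * Lob (A y) + -1 * Lob (B y) + -1 * Lob (phi + A y)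
  + -1 * Lob (phi - B y) + - / 2 * Lob (A y - B y)
  + / 2 * Lob (2 * phi + (A y - B y))).
assert (Hct : forall y, 0 <= y <= t -> 0 <= c * y < 1).
{ intros y Hy; split; [apply Rmult_le_pos; lra|].
  apply Rle_lt_trans with (c * t); [apply Rmult_le_compat_l; lra | lra]. }
assert (HA : forall y, 0 <= y <= t -> ex_derive A y).
{ intros y Hy; specialize (Hct y Hy); unfold A; auto_derive; lra. }
assert (HB : forall y, 0 <= y <= t -> ex_derive B y).
{ intros y Hy; specialize (Hct y Hy); unfold B; auto_derive; lra. }
assert (Hcont : forall y, 0 <= y <= t -> continuous f y).
{ intros y Hy; specialize (HA y Hy); specialize (HB y Hy).
  unfold f; continuous_Lob auto. }
assert (Hd : forall y, 0 < y < t -> is_derive f y 0).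
{ intros y Hy.
  specialize (HA y ltac:(lra)); specialize (HB y ltac:(lra)).
  specialize (Hct y ltac:(lra)).
  assert (Hcy : 0 < c * y) by (apply Rmult_lt_0_compat; lra).
  assert (H1 : 0 < B y < A y).
  { unfold A, B; rewrite <- atan_0 at 1; split; apply atan_increasing.
    - apply Rdiv_lt_0_compat; lra.
    - apply Rmult_lt_compat_l; [lra|].
      apply Rinv_lt_contravar; [apply Rmult_lt_0_compat|]; lra. }
  assert (H2 : A y < PI / 2) by apply atan_bound.
  assert (H3 : 0 < phi < PI / 2).
  { split; [|apply atan_bound].
    unfold phi; rewrite <- atan_0; apply atan_increasing, Rinv_0_lt_compat, Hc. }
  set (k := cos phi); set (a := cos (A y)); set (b := cos (B y)).
  assert (Hk : 0 < k) by apply cos_atan_pos.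
  assert (Ha : 0 < a) by apply cos_atan_pos.
  assert (Hb : 0 < b) by apply cos_atan_pos.
  assert (Hsk : sin phi = / c * k) by apply sin_atan_mul.
  assert (Hsa : sin (A y) = y / (1 - c * y) * a) by apply sin_atan_mul.
  assert (Hsb : sin (B y) = y / (1 + c * y) * b) by apply sin_atan_mul.
  (* Here y (c / k) is the modulus of z = y (c + i). [E1], [E2] and [E3] are the law of sines in the
     triangles with vertices 0, 1 and respectively z, - z, z^2. *)
  assert (E1 : sin (A y) = y * (c / k) * sin (phi + A y)).
  { rewrite sin_plus, Hsa, Hsk; fold k a; field; lra. }
  assert (E2 : sin (B y) = y * (c / k) * sin (phi - B y)).
  { rewrite sin_minus, Hsb, Hsk; fold k b; field; lra. }
  assert (E3 : sin (A y - B y)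
    = (y * (c / k)) ^ 2 * sin (2 * phi + (A y - B y))).
  { replace (2 * phi + (A y - B y)) with ((phi + A y) + (phi - B y)) by ring.
    rewrite (sin_plus (phi + A y)), !sin_plus, !sin_minus, cos_plus, cos_minus.
    rewrite Hsa, Hsb, Hsk; fold k a b; field; lra. }
  assert (Hyck : 0 < y * (c / k))
    by (apply Rmult_lt_0_compat; [lra | now apply Rdiv_lt_0_compat]).
  assert (S1 : 0 < sin (phi + A y)) by (apply sin_gt_0; lra).
  assert (S2 : 0 < sin (phi - B y)).
  { assert (0 < sin (B y)) by (apply sin_gt_0; lra).
    apply (Rmult_lt_reg_l (y * (c / k))); lra. }
  assert (S3 : 0 < sin (2 * phi + (A y - B y))).
  { assert (0 < sin (A y - B y)) by (apply sin_gt_0; lra).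
    apply (Rmult_lt_reg_l ((y * (c / k)) ^ 2)); [apply pow_lt|]; lra. }
  (* The ranges of the last two angles are recovered from the positivity of their sines. *)
  assert (R2 : 0 < phi - B y).
  { apply Rnot_le_lt; intros R2.
    assert (0 <= sin (B y - phi)) by (apply sin_ge_0; lra).
    replace (phi - B y) with (- (B y - phi)) in S2 by ring.
    rewrite sin_neg in S2; lra. }
  assert (R3 : 2 * phi + (A y - B y) < PI).
  { apply Rnot_le_lt; intros R3.
    assert (sin (2 * phi + (A y - B y)) <= 0) by (apply sin_le_0; lra).
    lra. }
  (* With L = ln |z|, the coefficients of the derivatives of A and B are L - 2 L / 2 up to sign,
     hence 0. *)
  set (L := ln (y * (c / k))).
  assert (L1 : ln (2 * sin (A y)) = L + ln (2 * sin (phi + A y))).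
  { rewrite E1; unfold L; rewrite <- ln_mult by lra; f_equal; ring. }
  assert (L2 : ln (2 * sin (B y)) = L + ln (2 * sin (phi - B y))).
  { rewrite E2; unfold L; rewrite <- ln_mult by lra; f_equal; ring. }
  assert (L3 : ln (2 * sin (A y - B y))
    = 2 * L + ln (2 * sin (2 * phi + (A y - B y)))).
  { rewrite E3; unfold L; set (u := y * (c / k)) in *; clearbody u.
    replace (2 * (u ^ 2 * _)) with (u * u * (2 * sin (2 * phi + (A y - B y))))
      by ring.
    rewrite !ln_mult by (repeat apply Rmult_lt_0_compat; lra); ring. }
  eapply is_derive_congr; [unfold f; derive_Lob auto; lra|].
  change zero with 0; rewrite L1, L2, L3; field. }
intros A' B'.
(* At 0 both A and B vanish and f is - 2 Lob(phi) + Lob(2 phi) / 2, which gives the constant terms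
   of the statement. *)
assert (E : f t = f 0) by (apply constant_of_derive_0; auto; lra).
unfold f, A, B, Rdiv in E.
rewrite !Rmult_0_l, atan_0, Rminus_0_r, !Rplus_0_r, Rminus_0_r, Lob_0 in E.
rewrite (Rplus_0_r (2 * phi)) in E.
fold (Rdiv t (1 - c * t)) (Rdiv t (1 + c * t)) A' B' in E.
lra.
Qed.

(** * Specialization to the angles of the theorem *)

Lemma tan_eq_atan_mod_PI (x y : R) : y <> 0 -> tan x = y ->
  exists k : Z, x = atan y + IZR k * PI.
Proof.
intros Hy Hx.
(* If cos x = 0, the convention / 0 = 0 makes [tan x] equal to 0, which y <> 0 excludes. *)
assert (Hc : cos x <> 0).
{ intros Hc; apply Hy; rewrite <- Hx; unfold tan; rewrite Hc.
  unfold Rdiv; rewrite Rinv_0; ring. }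
destruct (sin_eq_0_0 (x - atan y)) as [k Hk].
- rewrite sin_minus, sin_atan_mul, <- Hx; unfold tan; field; exact Hc.
- exists k; lra.
Qed.

(** Identifies an arctangent through an equation without quotients of y, which [field] can check
    after the addition formulas. *)
Lemma atan_eq (x y : R) : - (PI / 2) < y < PI / 2 -> sin y = x * cos y ->
  atan x = y.
Proof.
intros Hy Hs.
assert (0 < cos y) by (apply cos_gt_0; lra).
rewrite <- (atan_tan y Hy); f_equal; unfold tan; rewrite Hs; field; lra.
Qed.

Lemma Cl2_eq_Lob (x y : R) (k : Z) : x = 2 * (y + IZR k * PI) ->
  Cl2 x = 2 * Lob y.
Proof.
intros ->; rewrite <- (Lob_plus_IZR_PI y k); unfold Lob; field.
Qed.

Theorem mainTheorem6 (alpha beta : R)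
  (halpha : tan alpha = 1 / sqrt 2)
  (hbeta : tan beta = sqrt 8 + sqrt 3) :
  Cl2 (PI - 2 * beta) + Cl2 (2 * beta - 4 * alpha) + Cl2 (2 * beta - 2 * alpha)
  - Cl2 (2 * beta + 2 * alpha - PI) - Cl2 (2 * alpha)
  - 2 * Cl2 (PI - 4 * alpha) - 2 * Cl2 (PI + 2 * alpha) = 0.
Proof.
pose proof PI_RGT_0.
set (g := sqrt 2) in *; set (h := sqrt 3) in *.
assert (Hg : g * g = 2) by (apply sqrt_sqrt; lra).
assert (Hh : h * h = 3) by (apply sqrt_sqrt; lra).
assert (Hg0 : 0 < g) by (apply sqrt_lt_R0; lra).
assert (Hh0 : 0 < h) by (apply sqrt_lt_R0; lra).
assert (Hg1 : 1 < g < 3 / 2) by (split; nra).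
assert (Hh1 : h < 2) by nra.
replace (sqrt 8) with (2 * g) in hbeta
  by (replace 8 with (2 * 2 * 2) by ring;
      rewrite sqrt_mult, sqrt_square by lra; reflexivity).
replace (1 / g) with (g / 2) in halpha
  by (apply (Rmult_eq_reg_r g); [field_simplify; lra | lra]).
clearbody g h.
destruct (tan_eq_atan_mod_PI alpha (g / 2)) as [k Hk]; [lra | exact halpha |].
destruct (tan_eq_atan_mod_PI beta (2 * g + h)) as [l Hl]; [lra | exact hbeta |].
set (a := atan (g / 2)) in *; set (b := atan (2 * g + h)) in *.
assert (Ha : 0 < a < PI / 4).
{ unfold a; rewrite <- atan_0, <- atan_1; split; apply atan_increasing; lra. }
assert (Hb : 0 < b < PI / 2).
{ split; [|apply atan_bound].
  unfold b; rewrite <- atan_0; apply atan_increasing; lra. }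
assert (Sa : sin a = g / 2 * cos a) by apply sin_atan_mul.
assert (Sb : sin b = (2 * g + h) * cos b) by apply sin_atan_mul.
assert (Hc : 2 * g * (h / 9) < 1) by nra.
assert (Ephi : atan (/ (2 * g)) = PI / 2 - 2 * a).
{ apply atan_eq; [lra|].
  rewrite sin_shift, cos_shift, cos_2a, sin_2a, Sa.
  field [Hg Hh]; lra. }
(* Since g^2 = 2, (g / 2)^3 = 1 / (2 g): the second angle of the cubic relation is the angle phi of
   the square relation, which is what links the two. *)
assert (Eq : atan ((g / 2) ^ 3) = PI / 2 - 2 * a).
{ rewrite <- Ephi; f_equal; field [Hg]; lra. }
assert (EA : atan (h / 9 / (1 - 2 * g * (h / 9))) = a + b - PI / 2).
{ apply atan_eq; [lra|].
  replace (a + b - PI / 2) with (- (PI / 2 - (a + b))) by ring.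
  rewrite sin_neg, cos_neg, sin_shift, cos_shift, cos_plus, sin_plus, Sa, Sb.
  field [Hg Hh]; lra. }
assert (EB : atan (h / 9 / (1 + 2 * g * (h / 9))) = b - 2 * a).
{ apply atan_eq; [lra|].
  rewrite sin_minus, cos_minus, sin_2a, cos_2a, Sa, Sb.
  field [Hg Hh]; nra. }
pose proof (Lob_cubic_relation (g / 2) ltac:(lra)) as HR; cbv zeta in HR.
(* [- 1 / z] is [t (c + i)] with [c = 2 sqrt 2] and [t = sqrt 3 / 9]. *)
pose proof (Lob_square_relation (2 * g) (h / 9) ltac:(lra) ltac:(lra) Hc) as HS.
cbv zeta in HS; rewrite Ephi, EA, EB in HS; rewrite Eq in HR; fold a in HR.
pose proof (Lob_double a ltac:(lra)) as D1.
pose proof (Lob_double (2 * a) ltac:(lra)) as D2.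
assert (E4 : Lob (2 * (PI / 2 - 2 * a)) = - Lob (2 * (2 * a))).
{ rewrite <- Lob_opp, <- (Lob_plus_IZR_PI (- (2 * (2 * a))) 1); f_equal; field. }
replace (PI / 2 - 2 * a + (a + b - PI / 2)) with (b - a) in HS by ring.
replace (PI / 2 - 2 * a - (b - 2 * a)) with (PI / 2 - b) in HS by ring.
replace (a + b - PI / 2 - (b - 2 * a)) with (a - (PI / 2 - 2 * a)) in HS by ring.
replace (2 * (PI / 2 - 2 * a) + (a - (PI / 2 - 2 * a))) with (PI / 2 - a) in HS
  by ring.
replace (a + (PI / 2 - 2 * a)) with (PI / 2 - a) in HR by ring.
replace (PI / 2 - (PI / 2 - a)) with a in HR by ring.
(* Each argument is twice an angle built from a and b, up to the multiples of PI coming from k and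
   l, which [Lob] ignores. *)
rewrite (Cl2_eq_Lob _ (PI / 2 - b) (- l))
  by (rewrite opp_IZR; lra).
rewrite (Cl2_eq_Lob _ (b - 2 * a) (l - 2 * k))
  by (rewrite minus_IZR, mult_IZR; lra).
rewrite (Cl2_eq_Lob _ (b - a) (l - k)) by (rewrite minus_IZR; lra).
rewrite (Cl2_eq_Lob _ (a + b - PI / 2) (l + k)) by (rewrite plus_IZR; lra).
rewrite (Cl2_eq_Lob _ a k) by lra.
rewrite (Cl2_eq_Lob _ (PI / 2 - 2 * a) (- 2 * k))
  by (rewrite mult_IZR; lra).
rewrite (Cl2_eq_Lob _ (- (PI / 2 - a)) (k + 1)) by (rewrite plus_IZR; lra).
(* With all terms moved to the left, the goal is - 2 [HS] + [HR] + 3/2 [D1] + 1/2 [D2], where [E4]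
   eliminates Lob(PI - 4 a). *)
rewrite Lob_opp; lra.
Qed.
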